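(* Let $(\Omega,\Sigma,\mu)$ be a localizable measure space and let $E$ be a Banach function space (of $\mathbb{C}$-valued functions) over $(\Omega,\Sigma,\mu)$. For $\varphi\in L^\infty(\mu)$ let $M_\varphi\in\mathcal{L}(E)$ be the multiplication operator $f\mapsto\varphi f$, and let $\mathcal{M}_E(L^\infty(\mu))=\{M_\varphi:\varphi\in L^\infty(\mu)\}$. Then: (i) $\mathcal{M}_E(L^\infty(\mu))\subseteq\mathcal{L}^r(E)$. (ii) $\mathcal{M}_E(L^\infty(\mu))$ is inverse closed in $\mathcal{L}(E)$; that is, if $T\in\mathcal{M}_E(L^\infty(\mu))$ is invertible in $\mathcal{L}(E)$ (i.e., there exists $S\in\mathcal{L}(E)$ satisfying $ST=I=TS$), then necessarily $S\in\mathcal{M}_E(L^\infty(\mu))$. (iii) For every $T\in\mathcal{M}_E(L^\infty(\mu))$ we have $\sigma_{\rm o}(T)=\sigma(T)$.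
   Context: A measure space $(\Omega,\Sigma,\mu)$ is localizable if its measure algebra is a complete Boolean algebra and $\mu$ has the finite subset property: for every $A\in\Sigma$ with $\mu(A)>0$ there is $B\in\Sigma$ with $B\subseteq A$ and $0<\mu(B)<\infty$. A Banach function space $E$ over $(\Omega,\Sigma,\mu)$ is, in the standard sense, a vector space of ($\mu$-a.e. equivalence classes of) $\mathbb{C}$-valued measurable functions which is an ideal (if $f\in E$, $g$ is measurable and $|g|\le|f|$ $\mu$-a.e., then $g\in E$), equipped with a complete norm satisfying $\|g\|_E\le\|f\|_E$ whenever $|g|\le|f|$ $\mu$-a.e., and with full carrier (every $A\in\Sigma$ with $\mu(A)>0$ contains some $B\in\Sigma$ with $\mu(B)>0$ and $\chi_B\in E$). It is a complex Banach lattice for the pointwise $\mu$-a.e. order, and $\|M_\varphi\|_{\rm op}=\|\varphi\|_\infty$ for $\varphi\in L^\infty(\mu)$. For a complex Banach lattice $E$, $\mathcal{L}(E)$ is the unital Banach algebra of all continuous linear operators $E\to E$ (unit: the identity $I$). The spectrum of $T\in\mathcal{L}(E)$ is $\sigma(T)=\{\lambda\in\mathbb{C}:\lambda I-T \text{ is not invertible in }\mathcal{L}(E)\}$. An operator $T\in\mathcal{L}(E)$ is regular if it is a finite (complex) linear combination of positive operators; $\mathcal{L}^r(E)$ denotes the set of all regular operators, which is a unital algebra (a Banach algebra for the norm $\|T\|_r=\inf\{\|S\|_{\rm op}:S\in\mathcal{L}(E),\,S\ge0,\,|T(z)|\le S(|z|)\ \forall z\in E\}$). The order spectrum of $T\in\mathcal{L}^r(E)$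 is $\sigma_{\rm o}(T)=\{\lambda\in\mathbb{C}:\lambda I-T\text{ is not invertible in }\mathcal{L}^r(E)\}$. *)

(* Defs.v *)
From HB Require Import structures.
From mathcomp Require Import all_boot all_order all_algebra.
From mathcomp Require Import generic_quotient complex.
From mathcomp Require Import all_classical all_reals all_analysis.
From mathcomp Require Import measurable_realfun.

Set Implicit Arguments.
Unset Strict Implicit.
Unset Printing Implicit Defensive.

Import Order.TTheory GRing.Theory Num.Theory.
Import numFieldNormedType.Exports.

Local Open Scope classical_set_scope.
Local Open Scope complex_scope.
Local Open Scope ring_scope.

Section MeasureAlgebra.
Context d (Omega : measurableType d) (R : realType).
Variable mu : {measure set Omega -> \bar R}.

Let M := set_type (@measurable d Omega).

Let mset (A : set Omega) (mA : measurable A) : M := SigSub (mem_set mA).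

Definition null_diff (A B : M) : bool := `[< mu (val A `+` val B) = 0%E >].

Let mM (A : M) : measurable (val A). Proof. exact: set_mem (valP A). Qed.

Let nullW (A B : set Omega) : measurable A -> measurable B ->
  A `<=` B -> mu B = 0%E -> mu A = 0%E.
Proof. by move=> mA mB AB B0; exact: (subset_measure0 mA mB AB B0). Qed.

Let mY (A B : M) : measurable (val A `+` val B).
Proof. by rewrite setY_def; apply: measurableU; exact: measurableD. Qed.

Let null_diff_refl : reflexive null_diff.
Proof. by move=> A; apply/asboolP; rewrite setYK measure0. Qed.

Let null_diff_sym : symmetric null_diff.
Proof. by move=> A B; rewrite /null_diff setYC. Qed.

Let null_diffU (A B C D F G : M) :
  val A `+` val B `<=` (val C `+` val D) `|` (val F `+` val G) ->
  null_diff C D -> null_diff F G -> null_diff A B.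
Proof.
move=> sub /asboolP CD /asboolP FG; apply/asboolP.
apply: nullW sub _ => //; first exact: measurableU.
exact: null_set_setU.
Qed.

Let null_diff_trans : transitive null_diff.
Proof.
move=> B A C; apply: null_diffU => x.
by rewrite !setY_def /= => ACx; apply: contrapT; tauto.
Qed.

Canonical null_diff_equiv :=
  EquivRel null_diff null_diff_refl null_diff_sym null_diff_trans.

Local Open Scope quotient_scope.

Definition measure_algebra : Type := {eq_quot null_diff}.
HB.instance Definition _ := Choice.on measure_algebra.
HB.instance Definition _ := EqQuotient.on measure_algebra.

Implicit Types a b c : measure_algebra.

Let cls (A : M) : measure_algebra := \pi A.

Let mI (A B : M) : M := mset (measurableI _ _ (mM A) (mM B)).
Let mU (A B : M) : M := mset (measurableU _ _ (mM A) (mM B)).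
Let mC (A : M) : M := mset (measurableC (mM A)).

Definition ma_meet a b : measure_algebra := cls (mI (repr a) (repr b)).
Definition ma_join a b : measure_algebra := cls (mU (repr a) (repr b)).
Definition ma_compl a : measure_algebra := cls (mC (repr a)).
Definition ma_bot : measure_algebra := cls (mset measurable0).
Definition ma_top : measure_algebra := cls (mset measurableT).
Definition ma_le a b : bool := `[< mu (val (repr a) `\` val (repr b)) = 0%E >].
Definition ma_lt a b : bool := (b != a) && ma_le a b.

Let repr_cls (A : M) : null_diff (repr (cls A)) A.
Proof. by apply/eqmodP; rewrite reprK. Qed.

Let clsP (A B : M) : null_diff A B -> cls A = cls B.
Proof. by move=> AB; apply/eqmodP. Qed.

Let cls_inj (A B : M) : cls A = cls B -> null_diff A B.
Proof. by move/eqmodP. Qed.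

Let meetE A B : ma_meet (cls A) (cls B) = cls (mI A B).
Proof.
apply: clsP; apply: null_diffU (repr_cls A) (repr_cls B) => x.
by rewrite !setY_def /= => ABx; apply: contrapT; tauto.
Qed.

Let joinE A B : ma_join (cls A) (cls B) = cls (mU A B).
Proof.
apply: clsP; apply: null_diffU (repr_cls A) (repr_cls B) => x.
by rewrite !setY_def /= => ABx; apply: contrapT; tauto.
Qed.

Let complE A : ma_compl (cls A) = cls (mC A).
Proof.
apply: clsP; apply: null_diffU (repr_cls A) (repr_cls A) => x.
by rewrite !setY_def /= => ABx; apply: contrapT; tauto.
Qed.

Let eqM (A B : M) : val A = val B -> A = B. Proof. exact: val_inj. Qed.

Let le_def a b : ma_le a b = (ma_meet a b == a).
Proof.
rewrite -[X in _ == X]reprK -/(cls _); apply/asboolP/eqP => [ab|/cls_inj/asboolP].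
  by apply: clsP; apply/asboolP; rewrite /= setYC setYD.
by rewrite /= setYC setYD.
Qed.

Let lt_def a b : ma_lt a b = (b != a) && ma_le a b. Proof. by []. Qed.

Let meetC : commutative ma_meet.
Proof. by move=> a b; congr cls; apply: eqM; exact: setIC. Qed.

Let joinC : commutative ma_join.
Proof. by move=> a b; congr cls; apply: eqM; exact: setUC. Qed.

Let meetA : associative ma_meet.
Proof.
elim/quotW => A; elim/quotW => B; elim/quotW => C.
rewrite (meetE B C) (meetE A B) (meetE A) (meetE _ C).
by congr cls; apply: eqM; exact: setIA.
Qed.

Let joinA : associative ma_join.
Proof.
elim/quotW => A; elim/quotW => B; elim/quotW => C.
rewrite (joinE B C) (joinE A B) (joinE A) (joinE _ C).
by congr cls; apply: eqM; exact: setUA.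
Qed.

Let joinKI b a : ma_meet a (ma_join a b) = a.
Proof.
elim/quotW: a => A; elim/quotW: b => B; rewrite (joinE A B) (meetE A).
by congr cls; apply: eqM; apply/seteqP; split=> x /=; tauto.
Qed.

Let meetKU b a : ma_join a (ma_meet a b) = a.
Proof.
elim/quotW: a => A; elim/quotW: b => B; rewrite (meetE A B) (joinE A).
by congr cls; apply: eqM; apply/seteqP; split=> x /=; tauto.
Qed.

Let meetUl : left_distributive ma_meet ma_join.
Proof.
elim/quotW => A; elim/quotW => B; elim/quotW => C.
rewrite (joinE A B) (meetE A C) (meetE B C) (joinE (mI A C)) (meetE _ C).
by congr cls; apply: eqM; exact: setIUl.
Qed.

Let meetxx : idempotent_op ma_meet.
Proof.
by elim/quotW => A; rewrite meetE; congr cls; apply: eqM; exact: setIid.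
Qed.

Fact measure_algebra_display : Order.disp_t. Proof. exact: Order.Disp tt tt. Qed.

HB.instance Definition _ :=
  Order.isMeetJoinDistrLattice.Build measure_algebra_display measure_algebra
    le_def lt_def meetC joinC meetA joinA joinKI meetKU meetUl meetxx.

Let le0x a : (ma_bot <= a)%O.
Proof.
elim/quotW: a => A; rewrite leEmeet; apply/eqP/(etrans (meetE _ _)).
by congr cls; apply: eqM; exact: set0I.
Qed.

Let lex1 a : (a <= ma_top)%O.
Proof.
elim/quotW: a => A; rewrite leEmeet; apply/eqP/(etrans (meetE _ _)).
by congr cls; apply: eqM; exact: setIT.
Qed.

HB.instance Definition _ :=
  Order.hasBottom.Build measure_algebra_display measure_algebra le0x.
HB.instance Definition _ :=
  Order.hasTop.Build measure_algebra_display measure_algebra lex1.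

Let joinxC a : (a `|` ma_compl a)%O = (\top : measure_algebra)%O.
Proof.
elim/quotW: a => A; rewrite complE; apply: etrans (joinE _ _) _.
by congr cls; apply: eqM; exact: setUCr.
Qed.

Let meetxC a : (a `&` ma_compl a)%O = (\bot : measure_algebra)%O.
Proof.
elim/quotW: a => A; rewrite complE; apply: etrans (meetE _ _) _.
by congr cls; apply: eqM; exact: setICr.
Qed.

HB.instance Definition _ :=
  Order.TBDistrLattice_hasComplement.Build measure_algebra_display
    measure_algebra joinxC meetxC.

End MeasureAlgebra.

Definition complete_boolean_algebra d (B : ctbDistrLatticeType d) : Prop :=
  forall F : set B, supremums F !=set0.

Definition finite_subset_property d (Omega : measurableType d) (R : realType)
    (mu : {measure set Omega -> \bar R}) : Prop :=
  forall A, measurable A -> (0 < mu A)%E ->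
    exists B, [/\ measurable B, B `<=` A & (0 < mu B < +oo)%E].

Definition localizable d (Omega : measurableType d) (R : realType)
    (mu : {measure set Omega -> \bar R}) : Prop :=
  complete_boolean_algebra (measure_algebra mu) /\ finite_subset_property mu.

(* R[i] carries the Borel sigma-algebra of the plane R * R, transported along
   the bijection z |-> (Re z, Im z). *)

HB.instance Definition _ (R : realType) := isPointed.Build R[i] 0.

Definition ReIm (R : realType) (z : R[i]) : R * R := (complex.Re z, complex.Im z).

HB.instance Definition _ (R : realType) :=
  Measurable.copy R[i] (g_sigma_algebra_preimageType (@ReIm R)).

Lemma measurable_complexP d (Omega : measurableType d) (R : realType)
    (f : Omega -> R[i]) :
  measurable_fun setT f <->
  measurable_fun setT (@complex.Re R \o f) /\ measurable_fun setT (@complex.Im R \o f).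
Proof.
have -> : measurable_fun setT f <-> measurable_fun setT (@ReIm R \o f).
  split=> [mf _ B mB|mf _ _ [B mB <-]]; last first.
    by rewrite setTI; exact: mf.
  rewrite -[_ @^-1` _]/(f @^-1` (@ReIm R @^-1` B)).
  by apply: mf => //; exists B; rewrite ?setTI.
by split=> [/measurable_fun_pairP|[? ?]]; [|exact/measurable_fun_pairP].
Qed.

(* {mfun_ mu, Omega >-> R[i]} is the space L^0(mu) of classes of measurable
   functions modulo equality mu-a.e.; a class coerces to a representative. *)

Section AlmostEverywhere.
Context d (Omega : measurableType d) (R : realType).
Variable mu : {measure set Omega -> \bar R}.
Implicit Types f g h : {mfun_ mu, Omega >-> R[i]}.

Definition ae_nonneg f : Prop := \forall x \ae mu, 0 <= f x.

Definition ae_dominated g f : Prop := \forall x \ae mu, `|g x| <= `|f x|.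

Definition ae_lincomb h (a : R[i]) f g : Prop :=
  h = (fun x => a * f x + g x) %[ae mu].

Definition ae_product h f g : Prop := h = (fun x => f x * g x) %[ae mu].

Definition ae_indicator h (B : set Omega) : Prop :=
  h = (\1_B : Omega -> R[i]) %[ae mu].

Definition Linfty : set {mfun_ mu, Omega >-> R[i]} :=
  [set phi | exists M : R, \forall x \ae mu, `|phi x| <= M%:C].

End AlmostEverywhere.

(* A Banach function space is a Banach space identified by bfs_val with a linear
   subspace of L^0(mu). *)
HB.mixin Record isBanachFunctionSpace d (Omega : measurableType d) (R : realType)
    (mu : {measure set Omega -> \bar R}) (E : Type)
    & CompleteNormedModule R[i] E := {
  bfs_val : E -> {mfun_ mu, Omega >-> R[i]} ;
  bfs_val_inj : injective bfs_val ;
  bfs_val_linear : forall (a : R[i]) (f g : E),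
    ae_lincomb (bfs_val (a *: f + g)) a (bfs_val f) (bfs_val g) ;
  bfs_ideal : forall (f : E) (g : {mfun_ mu, Omega >-> R[i]}),
    ae_dominated g (bfs_val f) -> exists h : E, bfs_val h = g ;
  bfs_norm_monotone : forall f g : E,
    ae_dominated (bfs_val g) (bfs_val f) -> `|g| <= `|f| ;
  bfs_full_carrier : forall A : set Omega, measurable A -> (0 < mu A)%E ->
    exists B, [/\ measurable B, B `<=` A, (0 < mu B)%E &
      exists f : E, ae_indicator (bfs_val f) B] }.

#[short(type="banachFunctionSpaceType")]
HB.structure Definition BanachFunctionSpace d (Omega : measurableType d)
    (R : realType) (mu : {measure set Omega -> \bar R}) :=
  {E of isBanachFunctionSpace d Omega R mu E & CompleteNormedModule R[i] E}.

Section Operators.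
Context d (Omega : measurableType d) (R : realType).
Variable mu : {measure set Omega -> \bar R}.
Variable E : banachFunctionSpaceType mu.

Implicit Types (T S : E -> E) (A B : set (E -> E)).

(* L(E), as a set of plain functions; sums and multiples of operators are those
   of the pointwise vector space structure on E -> E *)
Definition bounded_op : set (E -> E) := [set T | linear T /\ continuous T].

Definition positive_op : set (E -> E) :=
  [set T | bounded_op T /\
    forall f : E, ae_nonneg (bfs_val f) -> ae_nonneg (bfs_val (T f))].

Definition regular_op : set (E -> E) :=
  [set T | bounded_op T /\
    exists (n : nat) (c : 'I_n -> R[i]) (P : 'I_n -> E -> E),
      (forall i, positive_op (P i)) /\ T = \sum_(i < n) c i *: P i].

Definition invertible_in A T : Prop :=
  exists S, [/\ A S, S \o T = idfun & T \o S = idfun].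

Definition spectrum_in A T : set R[i] :=
  [set lambda | ~ invertible_in A (lambda *: idfun - T)].

Definition spectrum T := spectrum_in bounded_op T.
Definition order_spectrum T := spectrum_in regular_op T.

(* f |-> phi f; the product lies in E when phi is in Linfty, see mulopE *)
Definition mulop (phi : {mfun_ mu, Omega >-> R[i]}) (f : E) : E :=
  xget 0 [set h : E | ae_product (bfs_val h) phi (bfs_val f)].

Definition multiplication_op : set (E -> E) :=
  [set mulop phi | phi in @Linfty _ _ _ mu].

Lemma mulopE phi (f : E) : Linfty phi ->
  ae_product (bfs_val (mulop phi f)) phi (bfs_val f).
Proof.
move=> [M phiM]; rewrite /mulop.
set P := [set h : E | _].
suff [h Ph] : exists h, P h by exact: (xgetPex 0 (ex_intro _ h Ph)).
have val0 : bfs_val (0 : E) = (fun=> 0 : R[i]) %[ae mu].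
  have := bfs_val_linear (1 : R[i]) (0 : E) 0; rewrite scaler0 addr0.
  apply: filterS => x /(_ I) + _; rewrite mul1r => /eqP.
  by rewrite -subr_eq0 opprD addrA subrr sub0r oppr_eq0 => /eqP.
have mprod : measurable_fun setT (fun x => phi x * bfs_val f x).
  have [mRp mIp] := (measurable_complexP phi).1 (measurable_funPT (repr phi)).
  have [mRf mIf] :=
    (measurable_complexP (bfs_val f)).1 (measurable_funPT (repr (bfs_val f))).
  apply/measurable_complexP; split.
    rewrite (_ : _ \o _ = ((@complex.Re R \o phi) \* (@complex.Re R \o bfs_val f)) \-
      ((@complex.Im R \o phi) \* (@complex.Im R \o bfs_val f))); last first.
      by apply/funext => x /=; case: (phi x) (bfs_val f x) => [? ?] [].
    by apply: measurable_funB; exact: measurable_funM.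
  rewrite (_ : _ \o _ = ((@complex.Re R \o phi) \* (@complex.Im R \o bfs_val f)) \+
    ((@complex.Im R \o phi) \* (@complex.Re R \o bfs_val f))); last first.
    by apply/funext => x /=; case: (phi x) (bfs_val f x) => [? ?] [].
  by apply: measurable_funD; exact: measurable_funM.
pose p : {mfun Omega >-> R[i]} :=
  HB.pack (fun x => phi x * bfs_val f x) (isMeasurableFun.Build _ _ _ _ _ mprod).
pose g : {mfun_ mu, Omega >-> R[i]} := \pi%qT p.
have gE : g = (fun x => phi x * bfs_val f x) %[ae mu].
  have : (repr g == p %[mod {mfun_ mu, Omega >-> R[i]}])%qT by rewrite reprK.
  by rewrite eqmodE => /asboolP.
have [|h hE] := bfs_ideal (M%:C *: f + 0) g; last first.
  by exists h; rewrite /P /= hE.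
have MfE := bfs_val_linear (M%:C : R[i]) f 0; rewrite /ae_lincomb in MfE.
have {}gE : \forall x \ae mu, g x = phi x * bfs_val f x /\ bfs_val (0 : E) x = 0.
  by move: gE val0; apply: filterS2 => x /(_ I) ? /(_ I).
rewrite /ae_dominated.
move: gE phiM MfE; apply: filterS3 => x [-> v0] pM /(_ I) ->.
rewrite v0 addr0 !normrM ler_wpM2r//.
have M0 : 0 <= M%:C :> R[i] by exact: le_trans pM.
by rewrite (ger0_norm M0).
Qed.

End Operators.

Arguments bounded_op {d Omega R mu} E.
Arguments positive_op {d Omega R mu} E.
Arguments regular_op {d Omega R mu} E.
Arguments multiplication_op {d Omega R mu} E.

(* Main.v *)
Require Import Defs.
From HB Require Import structures.
From mathcomp Require Import all_boot all_order all_algebra.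
From mathcomp Require Import complex.
From mathcomp Require Import all_classical all_reals all_analysis.
From mathcomp Require Import generic_quotient measurable_realfun ring.

(* If S is a bounded left inverse of M_phi, then |phi| >= c := 1/(2k) a.e., where
   k bounds S: otherwise full carrier provides a nonzero indicator f in E
   supported in {|phi| < c}, and then
   ||f|| = ||S (phi f)|| <= k c ||f|| = ||f||/2.
   Hence 1/phi is essentially bounded and S = M_{1/phi}. A multiplication
   operator is regular, being a combination of multiplications by essentially
   bounded nonnegative functions, so part (iii) follows by applying this to
   lambda I - M_phi = M_{lambda - phi}. *)

Import Order.TTheory GRing.Theory Num.Theory.
Import numFieldNormedType.Exports.

Local Open Scope classical_set_scope.
Local Open Scope complex_scope.
Local Open Scope ring_scope.

(** * Measurable classes obtained from real and imaginary parts *)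

Section Classes.
Context {d : measure_display} {Omega : measurableType d} {R : realType}.
Context {mu : {measure set Omega -> \bar R}}.
Implicit Types f g : {mfun_ mu, Omega >-> R[i]}.

Lemma class_exists (f : Omega -> R[i]) : measurable_fun setT f ->
  exists g : {mfun_ mu, Omega >-> R[i]}, g = f %[ae mu].
Proof.
move=> mf.
pose p : {mfun Omega >-> R[i]} :=
  HB.pack f (isMeasurableFun.Build _ _ _ _ _ mf).
exists (\pi%qT p : {mfun_ mu, Omega >-> R[i]}).
have : (repr (\pi%qT p : {mfun_ mu, Omega >-> R[i]}) == p
  %[mod {mfun_ mu, Omega >-> R[i]}])%qT by rewrite reprK.
by rewrite eqmodE => /asboolP.
Qed.

Lemma class_ext f g : f = g %[ae mu] -> f = g.
Proof.
by move=> fg; rewrite -[f]reprK -[g]reprK; apply/eqmodP/asboolP.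
Qed.

Lemma measurable_Re_class f : measurable_fun setT (@complex.Re R \o f).
Proof. by case/measurable_complexP: (measurable_funPT (repr f)). Qed.

Lemma measurable_Im_class f : measurable_fun setT (@complex.Im R \o f).
Proof. by case/measurable_complexP: (measurable_funPT (repr f)). Qed.

(** The squared modulus replaces the modulus in measurability arguments: it is real-valued and
    polynomial in the real and imaginary parts. *)
Lemma measurable_sqr_norm_class f :
  measurable_fun setT (fun x => complex.Re (f x) ^+ 2 + complex.Im (f x) ^+ 2).
Proof.
apply: measurable_funD.
  exact: measurable_funX (measurable_Re_class f).
exact: measurable_funX (measurable_Im_class f).
Qed.

Lemma normc_ge_Im (z : R[i]) : `|complex.Im z|%:C <= `|z|.
Proof.
by rewrite normc_def lecR -sqrtr_sqr ler_wsqrtr// lerDr sqr_ge0.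
Qed.

(** If [mu] is the zero measure, the bound in [Linfty] may be negative; its absolute value is still
    a bound. *)
Lemma Linfty_ge0 f : Linfty f ->
  exists2 M : R, 0 <= M & \forall x \ae mu, `|f x| <= M%:C.
Proof.
move=> [M fM]; exists `|M| => //.
by apply: filterS fM => x /le_trans; apply; rewrite lecR ler_norm.
Qed.

Lemma class_realC (u : Omega -> R) : measurable_fun setT u ->
  exists g : {mfun_ mu, Omega >-> R[i]}, g = (fun x => (u x)%:C) %[ae mu].
Proof.
move=> mu_u; apply: class_exists; apply/measurable_complexP; split => //.
exact: measurable_cst.
Qed.

Lemma class_cstB (a : R[i]) f :
  exists g : {mfun_ mu, Omega >-> R[i]}, g = (fun x => a - f x) %[ae mu].
Proof.
apply: class_exists; apply/measurable_complexP; split.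
  rewrite (_ : _ \o _ = cst (complex.Re a) \- (@complex.Re R \o f)).
    by apply: measurable_funB => //; exact: measurable_Re_class.
  by apply/funext => x /=; case: a (f x) => ? ? [].
rewrite (_ : _ \o _ = cst (complex.Im a) \- (@complex.Im R \o f)).
  by apply: measurable_funB => //; exact: measurable_Im_class.
by apply/funext => x /=; case: a (f x) => ? ? [].
Qed.

Lemma class_inv f :
  exists g : {mfun_ mu, Omega >-> R[i]}, g = (fun x => (f x)^-1) %[ae mu].
Proof.
pose n x := complex.Re (f x) ^+ 2 + complex.Im (f x) ^+ 2.
have mV : measurable_fun setT (fun x => (n x)^-1).
  (* The real power with exponent -1 is measurable and agrees with the inverse on nonnegative reals,
     including at 0, where both are 0. *)
  rewrite (_ : (fun _ => _) = (fun y => y `^ (-1)) \o n).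
    by apply: measurableT_comp (measurable_sqr_norm_class f).
  by apply/funext => x /=; rewrite powR_inv1// addr_ge0// sqr_ge0.
apply: class_exists; apply/measurable_complexP; split.
  rewrite (_ : _ \o _ = (@complex.Re R \o f) \* (fun x => (n x)^-1)).
    by apply: measurable_funM => //; exact: measurable_Re_class.
  by apply/funext => x; rewrite /n /=; case: (f x).
rewrite (_ : _ \o _ = (fun x => - (complex.Im (f x) * (n x)^-1))).
  apply: measurable_funN; apply: measurable_funM => //.
  exact: measurable_Im_class.
by apply/funext => x; rewrite /n /=; case: (f x).
Qed.

End Classes.

(** * Multiplication operators as bounded operators *)

Section Multiplication.
Context {d : measure_display} {Omega : measurableType d} {R : realType}.
Context {mu : {measure set Omega -> \bar R}} {E : banachFunctionSpaceType mu}.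
Implicit Types (f g : E) (phi psi : {mfun_ mu, Omega >-> R[i]}).

Lemma bfs_ext f g : bfs_val f = bfs_val g %[ae mu] -> f = g.
Proof. by move=> /class_ext/bfs_val_inj. Qed.

Lemma bfs_val0 : bfs_val (0 : E) = (fun=> 0 : R[i]) %[ae mu].
Proof.
have := bfs_val_linear (1 : R[i]) (0 : E) 0; rewrite scaler0 addr0.
apply: filterS => x /(_ I) + _; rewrite mul1r => /eqP.
by rewrite -subr_eq0 opprD addrA subrr sub0r oppr_eq0 => /eqP.
Qed.

Lemma bfs_valZ (a : R[i]) f :
  bfs_val (a *: f) = (fun x => a * bfs_val f x) %[ae mu].
Proof.
have := bfs_val_linear a f 0; rewrite addr0.
move: bfs_val0; apply: filterS2 => x /(_ I) f0 /(_ I) -> _.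
by rewrite f0 addr0.
Qed.

(** [mulop] is defined by choice; injectivity of [bfs_val] makes the chosen element unique, so
    identities between operators reduce to pointwise identities a.e. *)
Lemma mulop_unique phi f g : Linfty phi ->
  ae_product (bfs_val g) phi (bfs_val f) -> g = mulop phi f.
Proof.
move=> /(mulopE f) fE gE; apply: bfs_ext.
by move: fE gE; apply: filterS2 => x /(_ I) -> /(_ I) ->.
Qed.

Lemma mulop_linear phi : Linfty phi -> linear (mulop phi : E -> E).
Proof.
move=> phiL a f g; apply/esym/mulop_unique => //.
have h1 := bfs_val_linear a f g.
have h2 := bfs_val_linear a (mulop phi f) (mulop phi g).
have h3 : \forall x \ae mu, bfs_val (mulop phi f) x = phi x * bfs_val f x /\
    bfs_val (mulop phi g) x = phi x * bfs_val g x.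
  by move: (mulopE f phiL) (mulopE g phiL); apply: filterS2 => x /(_ I) ? /(_ I).
move: h1 h2 h3; apply: filterS3 => x /(_ I) -> /(_ I) -> [-> ->] _.
by rewrite mulrDr mulrCA.
Qed.

Lemma norm_mulop_le phi (M : R) f : 0 <= M ->
  (\forall x \ae mu, `|phi x| <= M%:C) -> `|mulop phi f| <= M%:C * `|f|.
Proof.
move=> M0 phiM; have M0' : 0 <= M%:C :> R[i] by rewrite lecR.
rewrite -[X in X * _]ger0_norm// -normrZ; apply: bfs_norm_monotone.
rewrite /ae_dominated.
move: phiM (bfs_valZ M%:C f) (mulopE f (ex_intro _ M phiM)).
apply: filterS3 => x phiM /(_ I) -> /(_ I) ->.
by rewrite !normrM (ger0_norm M0') ler_wpM2r.
Qed.

Lemma mulop_bounded phi : Linfty phi -> bounded_op E (mulop phi).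
Proof.
move=> phiL; split; first exact: mulop_linear.
have [M M0 phiM] := Linfty_ge0 phi phiL.
pose T : {linear E -> E} :=
  HB.pack (mulop phi : E -> E)
    (GRing.isLinear.Build _ _ _ _ _ (mulop_linear phi phiL)).
apply/(linear_bounded_continuous T)/linear_boundedP.
exists M%:C; split; first by apply: ger0_real; rewrite lecR.
move=> r Mr f; apply: le_trans (norm_mulop_le phi M f M0 phiM) _.
by rewrite ler_wpM2r// ltW.
Qed.

Lemma bounded_opP (S : E -> E) : bounded_op E S ->
  exists2 k : R, 0 < k & forall f, `|S f| <= k%:C * `|f|.
Proof.
move=> [linS contS].
pose T : {linear E -> E} :=
  HB.pack S (GRing.isLinear.Build _ _ _ _ _ linS).
have /linear_boundedP/pinfty_ex_gt0[r r0 Tr] : bounded_near T (nbhs 0).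
  exact/linear_bounded_continuous.
(* The bound is a complex number; being positive, it has zero imaginary part. *)
move: r r0 Tr => [a b]; rewrite ltcE /= => /andP[/eqP -> a0] Tr.
by exists a.
Qed.

(** * Positivity and regularity *)

Lemma mulop_positive phi : Linfty phi -> ae_nonneg phi ->
  positive_op E (mulop phi).
Proof.
move=> phiL phi0; split; first exact: mulop_bounded.
move=> f; rewrite /ae_nonneg; move: (mulopE f phiL) phi0.
by apply: filterS3 => x /(_ I) -> ? ?; rewrite mulr_ge0.
Qed.

Lemma mulop_inv phi psi : Linfty phi -> Linfty psi ->
  (\forall x \ae mu, phi x * psi x = 1) ->
  (mulop phi : E -> E) \o mulop psi = idfun.
Proof.
move=> phiL psiL phipsi; apply/funext => f /=; apply/esym/mulop_unique => //.
move: phipsi (mulopE f psiL); apply: filterS2 => x phipsi /(_ I) -> _.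
by rewrite mulrA phipsi mul1r.
Qed.

Lemma mulop_regular phi : Linfty phi -> regular_op E (mulop phi).
Proof.
move=> phiL; split; first exact: mulop_bounded.
have [M M0 phiM] := Linfty_ge0 phi phiL.
(* Here [u] will be the real or the imaginary part. As |u(phi)| <= M a.e., adding M gives a function
   with values in [0, 2M], hence a positive operator, without splitting into positive and negative
   parts. *)
have shift (u : R[i] -> R) : (forall z, `|u z|%:C <= `|z|) ->
    measurable_fun setT (u \o phi) ->
    exists p : {mfun_ mu, Omega >-> R[i]},
      [/\ Linfty p, p = (fun x => (u (phi x) + M)%:C) %[ae mu] &
        positive_op E (mulop p)].
  move=> u_le mu_phi.
  have [p pE] := class_realC (mu := mu) _ (measurable_funD mu_phi (measurable_cst M)).
  have uM : \forall x \ae mu, `|u (phi x)| <= M.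
    by apply: filterS phiM => x phix; rewrite -lecR (le_trans (u_le _)).
  have pL : Linfty p.
    exists (M + M); move: pE uM; apply: filterS2 => x /(_ I) -> uxM /=.
    rewrite normc_def /= expr0n addr0 sqrtr_sqr lecR.
    by rewrite (le_trans (ler_normD _ _))// (ger0_norm M0) lerD2r.
  exists p; split=> //; apply: mulop_positive => //.
  move: pE uM; apply: filterS2 => x /(_ I) -> uxM /=.
  by rewrite lecR -lerBlDr sub0r; move: uxM; rewrite ler_norml => /andP[].
have [p [pL pE pp]] := shift _ (@normc_ge_Re R) (measurable_Re_class phi).
have [q [qL qE qp]] := shift _ normc_ge_Im (measurable_Im_class phi).
(* phi = (Re phi + M) + i (Im phi + M) - (1 + i) M *)
pose P (i : 'I_3) : E -> E := [:: mulop p; mulop q; idfun]`_i.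
pose c (i : 'I_3) : R[i] := [:: 1; 'i%C; - (1 + 'i%C) * M%:C]`_i.
exists 3, c, P; split.
  case=> -[|[|[|//]]] i3 //=; rewrite /P/=.
  split=> //; split=> //.
  by move=> x; exact: cvg_id.
apply/funext => f; apply/esym/mulop_unique => //.
rewrite 3!big_ord_recl big_ord0 addr0.
(* The coefficient 1 is kept so that the sum has the shape a u + v evaluated by [bfs_val_linear]. *)
rewrite -[(_ + _) f]/(1 *: mulop p f +
  ('i%C *: mulop q f + c (lift ord0 (lift ord0 ord0)) *: f)).
set k := c _.
have qfE : \forall x \ae mu, bfs_val ('i%C *: mulop q f + k *: f) x =
    'i%C * ((complex.Im (phi x) + M)%:C * bfs_val f x) + k * bfs_val f x.
  have h : bfs_val (mulop q f) =
      (fun x => (complex.Im (phi x) + M)%:C * bfs_val f x) %[ae mu].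
    by move: qE (mulopE f qL); apply: filterS2 => x /(_ I) <- /(_ I).
  move: (bfs_val_linear 'i%C (mulop q f) (k *: f)) (bfs_valZ k f) h.
  by apply: filterS3 => x /(_ I) -> /(_ I) -> /(_ I) ->.
have pfE : bfs_val (mulop p f) =
    (fun x => (complex.Re (phi x) + M)%:C * bfs_val f x) %[ae mu].
  by move: pE (mulopE f pL); apply: filterS2 => x /(_ I) <- /(_ I).
rewrite /ae_product.
move: (bfs_val_linear 1 (mulop p f) ('i%C *: mulop q f + k *: f)) qfE pfE.
apply: filterS3 => x /(_ I) -> -> /(_ I) -> _.
rewrite [phi x in RHS]complexE /k /c /= !rmorphD/=.
ring.
Qed.

(** * Inverses of multiplication operators *)

Lemma mulop_bounded_below phi (S : E -> E) : Linfty phi -> bounded_op E S ->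
  S \o mulop phi = idfun ->
  exists2 c : R, 0 < c & \forall x \ae mu, c%:C <= `|phi x|.
Proof.
move=> phiL /bounded_opP[k k0 Sk] ST.
pose c := (k *+ 2)^-1.
have c0 : 0 < c by rewrite invr_gt0 mulrn_wgt0.
have c0' : 0 <= c%:C :> R[i] by rewrite lecR ltW.
exists c => //.
(* This is {|phi| < c}, squared so that measurability follows from a comparison of real
   functions. *)
pose A := [set x | complex.Re (phi x) ^+ 2 + complex.Im (phi x) ^+ 2 < c ^+ 2].
have mA : measurable A.
  have := measurable_fun_ltr (measurable_sqr_norm_class phi)
    (measurable_cst (c ^+ 2)).
  by move=> /(_ measurableT [set true] I); rewrite setTI.
have AE x : A x <-> `|phi x| < c%:C.
  rewrite /A /= -ltcR add_Re2_Im2 rmorphXn/= ltr_pXn2r ?nnegrE//.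
have [muA|muA] := eqVneq (mu A) 0%E.
  exists A; split => // x /= xA; apply/AE.
  rewrite real_ltNge ?normr_real//; first exact/negP.
  by apply: gtr0_real; rewrite ltcR.
have [|B [mB BA muB [f fB]]] := bfs_full_carrier (s := E) A mA.
  by rewrite lt0e muA measure_ge0.
(* Otherwise the indicator of B would vanish a.e., making B null. *)
have f0 : f != 0.
  apply/eqP => f0; move: muB; rewrite (_ : mu B = 0%E) ?ltxx//.
  move: fB; rewrite f0 => fB.
  suff : \forall x \ae mu, ~ B x.
    move=> [N [mN N0 BN]]; apply: subset_measure0 N0 => //.
    by move=> x Bx; apply: BN => /=; exact.
  move: bfs_val0 fB; apply: filterS2 => x /(_ I) -> /(_ I) + Bx.
  by rewrite indicE mem_set// => /eqP; rewrite eq_sym oner_eq0.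
have phif : `|mulop phi f| <= c%:C * `|f|.
  rewrite -[X in X * _](ger0_norm c0') -normrZ.
  apply: bfs_norm_monotone; rewrite /ae_dominated.
  move: fB (bfs_valZ c%:C f) (mulopE f phiL).
  rewrite /ae_indicator; apply: filterS3 => x /(_ I) fx /(_ I) -> /(_ I) ->.
  (* Off B both sides vanish; on B, which lies in A, |phi| < c. *)
  rewrite !normrM fx indicE.
  have [xB|_] := boolP (x \in B); last by rewrite normr0 !mulr0.
  rewrite normr1 !mulr1 (ger0_norm c0').
  by apply/ltW/AE/BA/set_mem.
have := Sk (mulop phi f); rewrite -[S _]/((S \o mulop phi) f) ST /=.
have kc : k * c = 2^-1.
  by rewrite /c -(mulr_natr k) invfM mulrA divff ?mul1r ?gt_eqF.
have k0' : 0 <= k%:C :> R[i] by rewrite lecR ltW.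
(* The estimate is now |f| <= |f| / 2, impossible for nonzero f. *)
move=> /le_trans/(_ (ler_wpM2l k0' phif)); rewrite mulrA -rmorphM/= kc.
by rewrite ler_pMl ?normr_gt0// (lecR 1) invf_ge1// lern1.
Qed.

Lemma multiplication_left_inverse (T S : E -> E) :
  multiplication_op E T -> bounded_op E S -> S \o T = idfun ->
  multiplication_op E S.
Proof.
move=> [phi phiL <-] bS ST.
have [c c0 phic] := mulop_bounded_below phi S phiL bS ST.
have [psi psiE] := class_inv phi.
have c0' : 0 < c%:C :> R[i] by rewrite ltcR.
have psiL : Linfty psi.
  exists c^-1; move: psiE phic; apply: filterS2 => x /(_ I) -> phic.
  by rewrite normfV fmorphV/= lef_pV2// posrE// (lt_le_trans c0').
have phipsi : (mulop phi : E -> E) \o mulop psi = idfun.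
  apply: mulop_inv => //.
  move: psiE phic; apply: filterS2 => x /(_ I) -> phic.
  by rewrite divff// -normr_gt0 (lt_le_trans c0').
exists psi => //.
(* A left inverse equals a right inverse: M_psi = (S M_phi) M_psi = S (M_phi M_psi) = S. *)
by rewrite -[LHS]/(idfun \o mulop psi) -ST -compA phipsi.
Qed.

Lemma cstB_multiplication (T : E -> E) (a : R[i]) :
  multiplication_op E T -> multiplication_op E (a *: idfun - T).
Proof.
move=> [phi phiL <-].
have [psi psiE] := class_cstB a phi.
have psiL : Linfty psi.
  (* The modulus of [a] has type [R[i]], while [Linfty] asks for a real bound; its real part is the
     modulus itself. *)
  have [M phiM] := phiL; exists (complex.Re `|a| + M).
  move: psiE phiM; apply: filterS2 => x /(_ I) -> phiM.
  by rewrite (le_trans (ler_normB _ _))// rmorphD/= lerD//.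
exists psi => //; apply/funext => f; apply/esym/mulop_unique => //.
have -> : (a *: idfun - mulop phi) f = - 1 *: mulop phi f + a *: f
  by rewrite scaleN1r addrC.
rewrite /ae_product.
have afE : \forall x \ae mu, bfs_val (- 1 *: mulop phi f + a *: f) x =
    a * bfs_val f x - bfs_val (mulop phi f) x.
  move: (bfs_val_linear (-1) (mulop phi f) (a *: f)) (bfs_valZ a f).
  by apply: filterS2 => x /(_ I) -> /(_ I) ->; rewrite mulN1r addrC.
move: afE psiE (mulopE f phiL).
by apply: filterS3 => x -> /(_ I) -> /(_ I) -> _; rewrite mulrBl.
Qed.

End Multiplication.

Theorem proposition2p1 (d : measure_display) (Omega : measurableType d)
    (R : realType) (mu : {measure set Omega -> \bar R})
    (E : banachFunctionSpaceType mu) (mu_localizable : localizable mu) :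
  [/\ multiplication_op E `<=` regular_op E,
      forall T S : E -> E, multiplication_op E T -> bounded_op E S ->
        S \o T = idfun -> T \o S = idfun -> multiplication_op E S
    & forall T : E -> E, multiplication_op E T ->
        order_spectrum T = spectrum T].
Proof.
split.
- by move=> _ [phi phiL <-]; exact: mulop_regular.
- by move=> T S mT bS ST _; exact: multiplication_left_inverse mT bS ST.
(* Both inclusions are proved on resolvent sets. A bounded inverse of aI - T is a multiplication
   operator, hence regular; conversely, a regular inverse is bounded by definition. *)
- move=> T mT; apply/seteqP; split=> a /= + [S [bS ST TS]]; apply.
    exists S; split=> //.
    have [phi phiL <-] := multiplication_left_inverse _ _
      (cstB_multiplication _ a mT) bS ST.
    exact: mulop_regular.
  by exists S; split=> //; case: bS.
Qed.
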